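(* For every integer $d\ge 2$ there is a balanced simplicial manifold $BM_d$ with $3d$ vertices that triangulates $\mathbb{S}^{d-2}\times\mathbb{S}^1$ if $d$ is odd, and the nonorientable $\mathbb{S}^{d-2}$-bundle over $\mathbb{S}^1$ if $d$ is even.
   Context: A $(d-1)$-dimensional simplicial complex is balanced if its vertices can be colored with $d$ colors so that no face contains two vertices of the same color. A simplicial manifold is a simplicial complex whose geometric realization is a (closed) topological manifold. *)

(* Defs.v *)
From HB Require Import structures.
From Stdlib Require Import Relation_Operators.
From mathcomp Require Import all_boot all_order all_algebra.
From mathcomp Require Import all_classical all_reals all_analysis.

Set Implicit Arguments.
Unset Strict Implicit.
Unset Printing Implicit Defensive.

Import Order.TTheory GRing.Theory Num.Theory.
Import numFieldNormedType.Exports.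

Local Open Scope classical_set_scope.
Local Open Scope ring_scope.

Section Complexes.
Variable n : nat.
Implicit Type D : {set {set 'I_n}}.

(* A complex whose vertex set is exactly 'I_n: every singleton is a face. *)
Definition simplicial_complex D : Prop :=
  [/\ finset.set0 \in D,
      forall v : 'I_n, [set v]%SET \in D
    & forall s t : {set 'I_n}, s \in D -> t \subset s -> t \in D].

(* The number of vertices of a largest face, i.e. 1 + dim D. *)
Definition rank_complex D : nat := (\max_(s in D) #|s|)%N.

Definition proper_coloring (d : nat) D (c : 'I_n -> 'I_d) : Prop :=
  forall s : {set 'I_n}, s \in D ->
  forall u v, u \in s -> v \in s -> c u = c v -> u = v.

(* D is (d-1)-dimensional and properly colored by d colors. *)
Definition balanced (d : nat) D : Prop :=
  rank_complex D = d /\ exists c : 'I_n -> 'I_d, proper_coloring D c.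

(* Barycentric coordinates whose support is a face. *)
Definition realization_set (R : realType) D : set 'rV[R]_n :=
  [set x | [/\ forall i, 0 <= x ord0 i,
               \sum_i x ord0 i = 1
             & [set i | x ord0 i != 0]%SET \in D]].

Definition realization (R : realType) D : topologicalType :=
  set_type (@realization_set R D).

End Complexes.

Arguments realization_set {n} R D.
Arguments realization {n} R D.

Definition homeomorphic (X Y : topologicalType) : Prop :=
  exists (f : X -> Y) (g : Y -> X),
    [/\ continuous f, continuous g, cancel f g & cancel g f].

Definition locally_euclidean (R : realType) (m : nat) (X : topologicalType) :
    Prop :=
  forall x : X, exists (U : set X) (V : set 'rV[R]_m),
    [/\ open U, U x, open V & homeomorphic (set_type U) (set_type V)].

Definition closed_manifold (R : realType) (m : nat) (X : topologicalType) :
    Prop :=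
  [/\ hausdorff_space X, second_countable (T := X), compact [set: X]
    & locally_euclidean R m X].

Definition simplicial_manifold (R : realType) (m n : nat)
    (D : {set {set 'I_n}}) : Prop :=
  simplicial_complex D /\ closed_manifold R m (realization R D).

(* The unit sphere S^n for the Euclidean norm (the norm of 'rV[R]_n.+1 in the
   library is the sup norm). *)
Definition sphere_set (R : realType) (n : nat) : set 'rV[R]_n.+1 :=
  [set x | \sum_i x ord0 i ^+ 2 = 1].

Arguments sphere_set R n : clear implicits.

Definition sphere (R : realType) (n : nat) : topologicalType :=
  set_type (sphere_set R n).

Section MappingTorus.
Variables (R : realType) (X : topologicalType) (f : X -> X).

Definition unit_interval : set R := `[0, 1].

Let cylinder := (X * set_type unit_interval)%type.

Definition glue (p q : cylinder) : Prop :=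
  [/\ set_val p.2 = 1, set_val q.2 = 0 & q.1 = f p.1].

Definition torus_rel (p q : cylinder) : bool :=
  `[< clos_refl_sym_trans _ glue p q >].

Lemma torus_rel_refl : reflexive torus_rel.
Proof. by move=> p; apply/asboolP; exact: rst_refl. Qed.

Lemma torus_rel_sym : symmetric torus_rel.
Proof.
by move=> p q; apply/asboolP/asboolP => h; exact: rst_sym.
Qed.

Lemma torus_rel_trans : transitive torus_rel.
Proof.
move=> q p r /asboolP pq /asboolP qr; apply/asboolP; exact: rst_trans pq qr.
Qed.

Definition torus_equiv : equiv_rel cylinder :=
  EquivRel torus_rel torus_rel_refl torus_rel_sym torus_rel_trans.

(* X * [0, 1] / (x, 1) ~ (f x, 0), with the quotient topology. *)
Definition mapping_torus : topologicalType :=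
  quotient_topology {eq_quot torus_equiv}%qT.

End MappingTorus.

Section SphereBundle.
Variables (R : realType) (n : nat).

Definition reflect_row (x : 'rV[R]_n.+1) : 'rV[R]_n.+1 :=
  \row_i (if i == ord0 then - x ord0 i else x ord0 i).

Lemma reflect_row_sphere (x : sphere R n) :
  reflect_row (set_val x) \in sphere_set R n.
Proof.
apply/mem_set; rewrite /sphere_set /= -[RHS](set_valP x).
by apply: eq_bigr => i _; rewrite mxE; case: ifP => _ //; rewrite sqrrN.
Qed.

(* The reflection (x_0, x_1, ..., x_n) |-> (-x_0, x_1, ..., x_n) of S^n. *)
Definition sphere_reflection (x : sphere R n) : sphere R n :=
  exist _ (reflect_row (set_val x)) (reflect_row_sphere x).

(* An S^n-bundle over S^1 is the mapping torus of its monodromy, and it is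
   nonorientable when the monodromy reverses the orientation of the fiber; up to
   homeomorphism the only such bundle is the twisted product given by the
   reflection.  For n = 0 it is the connected double cover of S^1. *)
Definition nonorientable_sphere_bundle : topologicalType :=
  mapping_torus R sphere_reflection.

End SphereBundle.

(* Main.v *)
Require Import Defs.
From HB Require Import structures.
From Stdlib Require Import Relation_Operators.
From mathcomp Require Import all_boot all_order perm all_algebra.
From mathcomp Require Import all_classical all_reals all_analysis.
From mathcomp Require Import ring lra.

(** The vertices fall into three blocks of [d], one vertex of each color per
    block, and a facet is a transversal of the colors that meets exactly two
    blocks. The facets on two given blocks form the boundary of a
    cross-polytope minus two opposite facets, a cylinder over [S^(d-2)];
    crossing it from one block to the other is the antipodal map, as is seen
    by projecting [R^d] along the diagonal. Three cylinders are glued in a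
    cycle, so the realization is the mapping torus of the antipode of
    [S^(d-2)], in [R^(d-1)]. Rotating pairs of coordinates by half a turn
    deforms the antipode to the identity if [d] is odd and to a reflection
    if [d] is even.

    Concretely, a point of the sphere gives a vector [y] in [[0, 1]^d] with
    minimum 0 and maximum 1, cutting [y] at a level [k] gives the two
    weights [(y - k)^+] and [(k - y)^+], and these are distributed to the
    blocks while [k] zigzags between 0 and 1. Being a continuous map from a
    compact cylinder onto a Hausdorff space, this parametrization is a
    quotient map; off the ends of the cylinder it is an open embedding of a
    spherical shell, which gives charts. *)

Set Implicit Arguments.
Unset Strict Implicit.
Unset Printing Implicit Defensive.

Import Order.TTheory GRing.Theory Num.Theory.
Import numFieldNormedType.Exports.

Local Open Scope classical_set_scope.
Local Open Scope ring_scope.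
Local Open Scope quotient_scope.

(** * Homeomorphisms, subspaces, and maps from compact to Hausdorff spaces *)

Lemma homeomorphic_sym (X Y : topologicalType) :
  homeomorphic X Y -> homeomorphic Y X.
Proof. by move=> [f [g [cf cg fg gf]]]; exists g, f. Qed.

Lemma homeomorphic_trans (Y X Z : topologicalType) :
  homeomorphic X Y -> homeomorphic Y Z -> homeomorphic X Z.
Proof.
move=> [f [g [cf cg fg gf]]] [f' [g' [cf' cg' fg' gf']]].
exists (f' \o f), (g \o g'); split.
- by move=> x; apply: continuous_comp; [exact: cf|exact: cf'].
- by move=> x; apply: continuous_comp; [exact: cg'|exact: cg].
- exact: can_comp.
- exact: can_comp.
Qed.

Lemma set_val_continuous (T : topologicalType) (A : set T) :
  continuous (set_val : set_type A -> T).
Proof. exact: initial_continuous. Qed.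

Lemma continuous_set_val (X T : topologicalType) (A : set T)
    (f : X -> set_type A) :
  continuous (set_val \o f) -> continuous f.
Proof. exact: continuous_comp_initial. Qed.

Lemma hausdorff_inj (X Y : topologicalType) (f : X -> Y) :
  continuous f -> injective f -> hausdorff_space Y -> hausdorff_space X.
Proof.
move=> cf injf hY p q pq; apply: injf; apply: hY => A B Ap Bq.
have [x [Ax Bx]] := pq _ _ (cf p _ Ap) (cf q _ Bq).
by exists (f x).
Qed.

Lemma hausdorff_set_type (T : topologicalType) (A : set T) :
  hausdorff_space T -> hausdorff_space (set_type A).
Proof.
apply: (hausdorff_inj (@set_val_continuous _ A)) => x y; exact: val_inj.
Qed.

Lemma hausdorff_prod (X Y : topologicalType) :
  hausdorff_space X -> hausdorff_space Y -> hausdorff_space (X * Y)%type.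
Proof.
move=> hX hY [p1 p2] [q1 q2] pq; congr pair.
- apply: hX => A B Ap Bq.
  have [[x y] [Ax Bx]] := pq _ _ (cvg_fst Ap) (cvg_fst Bq).
  by exists x.
- apply: hY => A B Ap Bq.
  have [[x y] [Ax Bx]] := pq _ _ (cvg_snd Ap) (cvg_snd Bq).
  by exists y.
Qed.

Lemma compact_set_type (T : topologicalType) (A : set T) :
  compact A -> compact [set: set_type A].
Proof.
move=> cA F PF _; pose G := set_val @ F.
have GA : G A by rewrite /G /fmap /=; apply: filterE => x; exact: set_valP.
have [p [Ap Gp]] := cA G _ GA.
exists (SigSub (mem_set Ap)); split=> // B C FB.
rewrite nbhsE => -[D [[E oE <-] /= Ep] DC].
have [x [[y By <-] Ex]] : (set_val @` B) `&` E !=set0.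
  apply: Gp; last exact: open_nbhs_nbhs.
  rewrite /G /fmap /=; apply: (@filterS _ F _ B) FB => y By.
  by exists y.
by exists y; split=> //; exact: DC.
Qed.

Lemma closed_map (K B : topologicalType) (g : K -> B) (C : set K) :
  compact [set: K] -> hausdorff_space B -> continuous g -> closed C ->
  closed (g @` C).
Proof.
move=> cK hB cg cC; apply: compact_closed => //.
apply: continuous_compact; first exact: continuous_subspaceT.
exact: (subclosed_compact cC cK).
Qed.

Lemma homeomorphic_compact_hausdorff (K B : topologicalType) (g : K -> B) :
  compact [set: K] -> hausdorff_space B -> continuous g -> injective g ->
  (forall b, exists k, g k = b) -> homeomorphic K B.
Proof.
move=> cK hB cg injg surjg.
pose f b := projT1 (cid (surjg b)).
have fK : cancel f g by move=> b; rewrite /f; case: cid.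
have gK : cancel g f by move=> k; apply: injg; rewrite fK.
exists g, f; split=> //; apply/continuous_closedP => C cC.
rewrite (_ : _ @^-1` C = g @` C); first exact: closed_map.
apply/seteqP; split=> [b /= Cb|_ [k Ck <-]]; first by exists (f b).
by rewrite /= gK.
Qed.

(** * Recognizing a mapping torus *)

Section MappingTorusHomeo.
Variables (R : realType) (X B : topologicalType) (f : X -> X).
Local Notation I := (set_type (@unit_interval R)).
Variable g : X * I -> B.
Hypothesis cX : compact [set: X].
Hypothesis hB : hausdorff_space B.
Hypothesis cg : continuous g.
Hypothesis surjg : forall b, exists k, g k = b.
Hypothesis glueg : forall p q, Defs.glue f p q -> g p = g q.
Hypothesis fiberg : forall p q, g p = g q ->
  [\/ p = q, Defs.glue f p q | Defs.glue f q p].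

Lemma compact_cylinder : compact [set: X * I].
Proof.
rewrite -setXTT; apply: compact_setX => //.
by apply: compact_set_type; exact: segment_compact.
Qed.

(** By [glueg] and [fiberg], [g] identifies exactly the points that the quotient identifies, so it
    descends to a continuous bijection, whose source is compact as an image of the cylinder. *)
Lemma homeomorphic_mapping_torus : homeomorphic (mapping_torus R f) B.
Proof.
pose Q : quotType _ := {eq_quot torus_equiv R f}%qT.
have relE p q : torus_rel f p q -> g p = g q.
  move=> /asboolP; elim => {p q} [p q /glueg //|//|p q _ -> //|].
  by move=> p q r _ -> _ ->.
have piE p q : reflect (\pi_Q p = \pi_Q q) (torus_rel f p q).
  exact: (@eqmodP _ (torus_equiv R f) p q).
have reprE p : g (repr (\pi_Q p)) = g p.
  by apply: relE; apply/piE; rewrite reprK.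
(* Defined through chosen representatives; continuity comes from [h \o \pi_Q = g] and the quotient
   topology. *)
pose h : mapping_torus R f -> B := fun z => g (repr (z : Q)).
apply: (@homeomorphic_compact_hausdorff _ _ h) => //.
- have -> : [set: mapping_torus R f] = (\pi_Q : _ -> mapping_torus R f) @` setT.
    by apply/seteqP; split=> // z _; exists (repr (z : Q)) => //; exact: reprK.
  apply: continuous_compact; last exact: compact_cylinder.
  by apply: continuous_subspaceT; exact: pi_continuous.
- apply/quotient_continuous.
  by rewrite (_ : h \o _ = g)//; apply/funext => p; exact: reprE.
- move=> z1 z2; rewrite /h => e.
  rewrite -[z1](reprK (z1 : Q)) -[z2](reprK (z2 : Q)).
  apply/piE; apply/asboolP.
  have [->|gl|gl] := fiberg e; first exact: rst_refl.
    exact: rst_step.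
  by apply: rst_sym; exact: rst_step.
- move=> b; have [k <-] := surjg b; exists (\pi_Q k); exact: reprE.
Qed.

End MappingTorusHomeo.

(** * Continuity of coordinatewise and real-valued maps; second countability *)

Lemma cont_pair (X Y Z : topologicalType) (f : X -> Y) (g : X -> Z) :
  continuous f -> continuous g -> continuous (fun x => (f x, g x)).
Proof. by move=> cf cg x; apply: cvg_pair; [exact: cf|exact: cg]. Qed.

Lemma continuous_mx (X : topologicalType) (R : realType) (m n : nat)
    (f : X -> 'M[R]_(m, n)) :
  (forall i j, continuous (fun x => f x i j)) -> continuous f.
Proof.
move=> cf x A [P Pf PA].
suff : \forall y \near x, forall i j, P i j (f y i j).
  by apply: filterS => y Py; apply: PA.
apply: filter_forall => i; apply: filter_forall => j.
exact: (cf i j x _ (Pf i j)).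
Qed.

Lemma second_countable_set_type (R : realType) (T : pseudoMetricType R)
    (A : set T) :
  compact [set: set_type A] -> second_countable (T := set_type A).
Proof.
(* [compact_second_countable] is about pointed spaces, hence the choice of a point [a]; the empty
   subspace has the empty base. *)
have [a cA|A0] := pselect (exists a : set_type A, True); last first.
  exists set0; first exact: countable0.
  by split=> [//|x]; case: A0; exists x.
case: a => a _.
pose P := HB.pack_for (pseudoPMetricType R) (set_type A) (isPointed.Build _ a).
exact: (@compact_second_countable R P).
Qed.

Section RealContinuity.
Variables (R : realType) (X : topologicalType).
Implicit Types f g : X -> R.

Lemma cont_cst (c : R) : continuous (fun _ : X => c).
Proof. by move=> x; exact: cvg_cst. Qed.

Lemma contD f g : continuous f -> continuous g ->
  continuous (fun x => f x + g x).
Proof. by move=> cf cg x; apply: cvgD; [exact: cf|exact: cg]. Qed.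

Lemma contN f : continuous f -> continuous (fun x => - f x).
Proof. by move=> cf x; apply: cvgN; exact: cf. Qed.

Lemma contB f g : continuous f -> continuous g ->
  continuous (fun x => f x - g x).
Proof. by move=> cf cg; apply: contD => //; exact: contN. Qed.

Lemma contM f g : continuous f -> continuous g ->
  continuous (fun x => f x * g x).
Proof. by move=> cf cg x; apply: cvgM; [exact: cf|exact: cg]. Qed.

Lemma contV f : (forall x, f x != 0) -> continuous f ->
  continuous (fun x => (f x)^-1).
Proof. by move=> f0 cf x; apply: cvgV => //; exact: cf. Qed.

Lemma cont_norm f : continuous f -> continuous (fun x => `|f x|).
Proof. by move=> cf x; apply: cvg_norm; exact: cf. Qed.

Lemma cont_max f g : continuous f -> continuous g ->
  continuous (fun x => Num.max (f x) (g x)).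
Proof.
by move=> cf cg x; apply: (@continuous_max _ _ f g); [exact: cf|exact: cg].
Qed.

Lemma cont_min f g : continuous f -> continuous g ->
  continuous (fun x => Num.min (f x) (g x)).
Proof.
by move=> cf cg x; apply: (@continuous_min _ _ f g); [exact: cf|exact: cg].
Qed.

Lemma cont_coord (m n : nat) (F : X -> 'M[R]_(m, n)) i j :
  continuous F -> continuous (fun x => F x i j).
Proof.
move=> cF x; apply: (@continuous_comp _ _ _ F (fun M => M i j)); first exact: cF.
exact: coord_continuous.
Qed.

Lemma cont_sqrt f : continuous f -> continuous (fun x => Num.sqrt (f x)).
Proof.
move=> cf x; apply: continuous_comp; [exact: cf|exact: sqrt_continuous].
Qed.

Lemma cont_sum (I : finType) (F : I -> X -> R) :
  (forall i, continuous (F i)) -> continuous (fun x => \sum_i F i x).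
Proof.
move=> cF; elim: (index_enum I) => [|i s IHs].
  by under eq_fun do rewrite big_nil; exact: cont_cst.
by under eq_fun do rewrite big_cons; exact: contD.
Qed.

Lemma cont_bigmax (I : finType) (F : I -> X -> R) :
  (forall i, continuous (F i)) ->
  continuous (fun x => \big[Num.max/0]_i F i x).
Proof.
move=> cF; elim: (index_enum I) => [|i s IHs].
  by under eq_fun do rewrite big_nil; exact: cont_cst.
by under eq_fun do rewrite big_cons; exact: cont_max.
Qed.

Lemma cont_bigmin (I : finType) (F : I -> X -> R) :
  (forall i, continuous (F i)) ->
  continuous (fun x => \big[Num.min/0]_i F i x).
Proof.
move=> cF; elim: (index_enum I) => [|i s IHs].
  by under eq_fun do rewrite big_nil; exact: cont_cst.
by under eq_fun do rewrite big_cons; exact: cont_min.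
Qed.

End RealContinuity.

Lemma unit_interval_bounds (R : realType) (t : set_type (@unit_interval R)) :
  0 <= (set_val t : R) <= 1.
Proof. by have := set_valP t; rewrite /= /unit_interval /= in_itv. Qed.

(** * The Euclidean sphere *)

Section Sphere.
Variables (R : realType) (m : nat).
Local Notation I := (set_type (@unit_interval R)).

Definition sqn (v : 'rV[R]_m.+1) : R := \sum_i v ord0 i ^+ 2.

Lemma sqn_continuous : continuous sqn.
Proof.
apply: cont_sum => i; under eq_fun do rewrite expr2.
by apply: contM; exact: coord_continuous.
Qed.

Lemma sqn_ge0 v : 0 <= sqn v.
Proof. by apply: sumr_ge0 => i _; exact: sqr_ge0. Qed.

Lemma sqn_eq0 v : (sqn v == 0) = (v == 0).
Proof.
apply/eqP/eqP => [s0|->]; last by rewrite /sqn big1// => i _; rewrite mxE expr0n.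
apply/rowP => i; rewrite mxE; apply/eqP; rewrite -sqrf_eq0; apply/eqP.
by apply: (psumr_eq0P _ s0) => // j _; exact: sqr_ge0.
Qed.

Lemma sqn_gt0 v : (0 < sqn v) = (v != 0).
Proof. by rewrite lt_def sqn_ge0 andbT sqn_eq0. Qed.

Lemma sqnZ a v : sqn (a *: v) = a ^+ 2 * sqn v.
Proof. by rewrite /sqn mulr_sumr; apply: eq_bigr => i _; rewrite mxE exprMn. Qed.

Lemma sqn_sphere (u : sphere R m) : sqn (set_val u) = 1.
Proof. exact: (set_valP u). Qed.

Lemma sphere_neq0 (u : sphere R m) : set_val u != 0.
Proof. by rewrite -sqn_gt0 sqn_sphere ltr01. Qed.

Lemma compact_sphere : compact [set: sphere R m].
Proof.
apply: compact_set_type; apply: bounded_closed_compact; last first.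
  rewrite (_ : sphere_set R m = sqn @^-1` [set 1])//.
  apply: closed_comp => [v _|]; first exact: sqn_continuous.
  exact: accessible_closed_set1 (hausdorff_accessible (@Rhausdorff R)) _.
exists 1; split=> // M M1 v sv /=.
rewrite /Num.Def.normr /= mx_normrE.
apply: bigmax_le => [|[i j] _ /=]; first by rewrite ltW// (lt_trans _ M1).
rewrite (ord1 i) (le_trans _ (ltW M1))//.
(* The square of a coordinate is one term of a sum of squares equal to 1, which bounds the sup
   norm. *)
rewrite -(@ler_pXn2r _ 2)// ?nnegrE// expr1n real_normK ?num_real// -sv.
by rewrite (bigD1 j)//= lerDl; apply: sumr_ge0 => k _; exact: sqr_ge0.
Qed.

Definition direction (v : 'rV[R]_m.+1) := (Num.sqrt (sqn v))^-1 *: v.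

Lemma direction_sphere v : v != 0 -> direction v \in sphere_set R m.
Proof.
move=> v0; apply/mem_set; rewrite /sphere_set /=.
rewrite -/(sqn _) sqnZ exprVn sqr_sqrtr ?sqn_ge0// mulVf// sqn_eq0//.
Qed.

End Sphere.

(** * Charts on the interior of a sphere cylinder *)

Section Chart.
Variables (R : realType) (m : nat) (B : topologicalType).
Local Notation I := (set_type (@unit_interval R)).
Local Notation K := (sphere R m * I)%type.
Variable g : K -> B.
Hypothesis hB : hausdorff_space B.
Hypothesis cg : continuous g.
Hypothesis surjg : forall b, exists k, g k = b.
Hypothesis injg : forall p q, g p = g q -> 0 < set_val p.2 < 1 -> p = q.

Lemma compact_sphere_cylinder : compact [set: K].
Proof. by apply: compact_cylinder; exact: compact_sphere. Qed.

(** The points that neither end reaches: an open set, because [g] is a closed map. *)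
Let U := ~` (g @` [set p | set_val p.2 = 0 \/ set_val p.2 = 1]).

Let openU : open U.
Proof.
rewrite /U openC; apply: closed_map => //; first exact: compact_sphere_cylinder.
have cv : continuous (fun p : K => set_val p.2 : R).
  move=> p; apply: continuous_comp; first exact: cvg_snd.
  exact: set_val_continuous.
have cl (c : R) : closed [set p : K | set_val p.2 = c].
  apply: (@closed_comp _ _ _ [set c]) => [p _|]; first exact: cv.
  exact: accessible_closed_set1 (hausdorff_accessible (@Rhausdorff R)) _.
exact: (closedU (cl 0) (cl 1)).
Qed.

Let UP p : U (g p) -> 0 < set_val p.2 < 1.
Proof.
move=> Up; have /andP[p0 p1] := unit_interval_bounds p.2.
rewrite !lt_neqAle p0 p1 !andbT.
apply/andP; split; apply/eqP => e; case: Up; exists p => //=.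
  by left.
by right.
Qed.

(** The open shell between the radii 1 and 2. Height [t] corresponds to squared radius [1 + 3 t], so
    the origin is avoided and polar coordinates are continuous. *)
Let V := [set v : 'rV[R]_m.+1 | 1 < sqn v < 4].

Let openV : open V.
Proof.
rewrite (_ : V = @sqn R m @^-1` `]1, 4[).
  by apply: open_comp => [v _|]; [exact: sqn_continuous|exact: itv_open].
by apply/seteqP; split=> v /=; rewrite in_itv.
Qed.

Let VP (v : set_type V) : 1 < sqn (set_val v) < 4.
Proof. exact: set_valP v. Qed.

Let V_neq0 (v : set_type V) : set_val v != 0.
Proof.
by rewrite -sqn_gt0; have /andP[v1 _] := VP v; rewrite (lt_trans _ v1).
Qed.

Let height_itv (v : set_type V) :
  (sqn (set_val v) - 1) / 3 \in @unit_interval R.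
Proof.
apply/mem_set; rewrite /= /unit_interval /= in_itv /=.
by have /andP[v1 v2] := VP v; apply/andP; split; lra.
Qed.

Let polar (v : set_type V) : K :=
  (SigSub (direction_sphere (V_neq0 v)), SigSub (height_itv v)).

Let polar_continuous : continuous polar.
Proof.
have cs : continuous (fun v : set_type V => sqn (set_val v)).
  move=> v; apply: continuous_comp; first exact: set_val_continuous.
  exact: sqn_continuous.
apply: cont_pair.
- apply: continuous_set_val; apply: continuous_mx => i j /=.
  under eq_fun do rewrite /= mxE; apply: contM.
    apply: contV => [w|]; last exact: cont_sqrt.
    by rewrite sqrtr_eq0 -ltNge sqn_gt0.
  by apply: cont_coord; exact: set_val_continuous.
- apply: continuous_set_val; rewrite /comp /=.
  by apply: contM; [apply: contB => //|]; exact: cont_cst.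
Qed.

Let unpolar (p : K) : 'rV[R]_m.+1 :=
  Num.sqrt (1 + 3 * set_val p.2) *: set_val p.1.

Let sqn_unpolar p : sqn (unpolar p) = 1 + 3 * set_val p.2.
Proof.
have /andP[p0 _] := unit_interval_bounds p.2.
by rewrite sqnZ sqn_sphere mulr1 sqr_sqrtr//; lra.
Qed.

Let unpolar_continuous : continuous unpolar.
Proof.
apply: continuous_mx => i j; under eq_fun do rewrite mxE; apply: contM.
  apply: cont_sqrt; apply: contD; first exact: cont_cst.
  apply: contM; first exact: cont_cst.
  move=> p; apply: continuous_comp; first exact: cvg_snd.
  exact: set_val_continuous.
apply: cont_coord => p.
by apply: continuous_comp; [exact: cvg_fst|exact: set_val_continuous].
Qed.

Let polarK v : unpolar (polar v) = set_val v.
Proof.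
rewrite /unpolar /= mulrC divfK ?pnatr_eq0// addrC subrK scalerA divff ?scale1r//.
by rewrite sqrtr_eq0 -ltNge sqn_gt0.
Qed.

Let unpolarK v p : set_val v = unpolar p -> polar v = p.
Proof.
case: p => u t e; congr pair; apply: val_inj; rewrite /= /direction e sqn_unpolar /=.
  rewrite /unpolar scalerA mulVf ?scale1r// sqrtr_eq0 -ltNge.
  by have /andP[t0 _] := unit_interval_bounds t; lra.
by rewrite addrAC subrr add0r mulrC mulKf// pnatr_eq0.
Qed.

(* [g] is a closed map, so over [U], where it is injective, its inverse is
   continuous. *)
Lemma open_shell_chart x : (forall p, g p = x -> 0 < set_val p.2 < 1) ->
  exists (U : set B) (V : set 'rV[R]_m.+1),
    [/\ open U, U x, open V & homeomorphic (set_type U) (set_type V)].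
Proof.
move=> x01; exists U, V; split=> //.
  by move=> [p + /x01]; move=> /= [->|->]; rewrite ltxx ?andbF.
pose k (b : set_type U) := projT1 (cid (surjg (set_val b))).
have kK b : g (k b) = set_val b by rewrite /k; case: cid.
have k01 b : 0 < set_val (k b).2 < 1.
  by apply: UP; rewrite kK; exact: set_valP.
have kE b p : g p = set_val b -> k b = p.
  by move=> gp; apply: injg => //; rewrite kK.
have ck : continuous k.
  apply/continuous_closedP => C cC.
  rewrite (_ : k @^-1` C = set_val @^-1` (g @` C)).
    apply: closed_comp => [b _|]; first exact: set_val_continuous.
    by apply: closed_map => //; exact: compact_sphere_cylinder.
  apply/seteqP; split=> [b Cb|b [p Cp /kE kbp]]; first by exists (k b).
  by rewrite /= kbp.
have Vk b : unpolar (k b) \in V.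
  apply/mem_set; rewrite /V /= sqn_unpolar.
  by have /andP[? ?] := k01 b; apply/andP; split; lra.
have Ug v : g (polar v) \in U.
  apply/mem_set => -[p p01 gp].
  have /andP[v1 v4] := VP v.
  have pv01 : 0 < set_val (polar v).2 < 1.
    change (0 < (sqn (set_val v) - 1) / 3 < 1); apply/andP; split; lra.
  (* Injectivity over the interior identifies [polar v] with [p], which lies on an end. *)
  have := pv01; rewrite (injg (esym gp) pv01).
  by case: p01 => ->; rewrite ltxx ?andbF.
exists (fun b => SigSub (Vk b)), (fun v => SigSub (Ug v)); split.
- apply: continuous_set_val => b.
  apply: (@continuous_comp _ _ _ k unpolar); first exact: ck.
  exact: unpolar_continuous.
- apply: continuous_set_val => v.
  apply: (@continuous_comp _ _ _ polar g); last exact: cg.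
  exact: polar_continuous.
- move=> b; apply: val_inj; change (g (polar (SigSub (Vk b))) = set_val b).
  by rewrite -kK; congr g; exact: unpolarK.
- move=> v; apply: val_inj; change (unpolar (k (SigSub (Ug v))) = set_val v).
  by rewrite (@kE _ (polar v)) ?polarK.
Qed.

End Chart.

(** * The mapping torus of the identity is a product with the circle *)

Section Circle.
Variable R : realType.
Local Notation I := (set_type (@unit_interval R)).

(* The square of the point of the upper half-circle with abscissa [1 - 2 t]. *)
Definition circle_row (t : R) : 'rV[R]_2 :=
  \row_i (if i == ord0 then 2 * (1 - 2 * t) ^+ 2 - 1
          else 2 * (1 - 2 * t) * Num.sqrt (1 - (1 - 2 * t) ^+ 2)).

Lemma circle_row_sphere (t : I) : circle_row (set_val t) \in sphere_set R 1.
Proof.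
apply/mem_set; rewrite /sphere_set /= !big_ord_recl big_ord0 addr0 !mxE /=.
have /andP[] := unit_interval_bounds t; move: (set_val t : R) => {}t t0 t1.
by rewrite [in X in _ + X]exprMn sqr_sqrtr; [ring|nra].
Qed.

Definition circle_point (t : I) : sphere R 1 := SigSub (circle_row_sphere t).

Lemma circle_point_continuous : continuous circle_point.
Proof.
have cc : continuous (fun t : I => 1 - 2 * (set_val t : R)).
  apply: contB; first exact: cont_cst.
  by apply: contM; [exact: cont_cst|exact: set_val_continuous].
apply: continuous_set_val; apply: continuous_mx => i j /=.
under eq_fun do rewrite /= mxE expr2; case: (j == ord0).
  apply: contB; last exact: cont_cst.
  by apply: contM; [exact: cont_cst|exact: contM].
apply: contM; first by apply: contM; [exact: cont_cst|].
apply: cont_sqrt; apply: contB; first exact: cont_cst.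
exact: contM.
Qed.

Lemma circle_point_surj (u : sphere R 1) : exists t, circle_point t = u.
Proof.
have := sqn_sphere u; rewrite /sqn !big_ord_recl big_ord0 addr0.
set x := (set_val u) ord0 ord0; set y := (set_val u) ord0 (lift ord0 ord0) => xy.
have xge : -1 <= x by nra.
have xle : x <= 1 by nra.
(* Half-angle formula: [c] is the abscissa of the square root of [x + i y] in the upper half-circle,
   so it has the sign of [y]. *)
pose c := (if 0 <= y then 1 else -1) * Num.sqrt ((1 + x) / 2).
have c2 : c ^+ 2 = (1 + x) / 2.
  rewrite /c exprMn sqr_sqrtr; last by lra.
  by case: ifP => _; rewrite ?sqrrN expr1n mul1r.
have t01 : (1 - c) / 2 \in @unit_interval R.
  apply/mem_set; rewrite /unit_interval /= in_itv /=.
  by apply/andP; split; nra.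
exists (SigSub t01); apply: val_inj; apply/rowP => i; rewrite mxE /=.
have -> : 1 - 2 * ((1 - c) / 2) = c by field.
have [->|i0] := eqVneq i ord0; first by rewrite c2 -/x; field.
have -> : i = lift ord0 ord0.
  by apply: val_inj; case: i i0 => -[|[]].
rewrite c2 -[(set_val u) _ _]/y.
have -> : 2 * c = (if 0 <= y then 1 else -1) * (2 * Num.sqrt ((1 + x) / 2)).
  by rewrite /c mulrCA.
rewrite -mulrA -mulrA -sqrtrM; last by lra.
have -> : (1 + x) / 2 * (1 - (1 + x) / 2) = (`|y| / 2) ^+ 2.
  by rewrite expr_div_n real_normK ?num_real//; nra.
rewrite sqrtr_sqr ger0_norm ?divr_ge0// [2 * _]mulrC divfK ?pnatr_eq0//.
have [y0|y0] := leP 0 y; first by rewrite mul1r ger0_norm.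
by rewrite mulN1r ltr0_norm ?opprK.
Qed.

Lemma circle_row_fiber (s t : I) :
  circle_row (set_val s) = circle_row (set_val t) ->
  [\/ s = t, set_val s = 1 /\ set_val t = 0
    | set_val t = 1 /\ set_val s = 0].
Proof.
move=> /rowP e.
have := e ord0; have := e (lift ord0 ord0); rewrite !mxE /=.
suff : forall a b : R, 0 <= a <= 1 -> 0 <= b <= 1 ->
  2 * (1 - 2 * a) * Num.sqrt (1 - (1 - 2 * a) ^+ 2) =
  2 * (1 - 2 * b) * Num.sqrt (1 - (1 - 2 * b) ^+ 2) ->
  2 * (1 - 2 * a) ^+ 2 - 1 = 2 * (1 - 2 * b) ^+ 2 - 1 ->
  [\/ a = b, a = 1 /\ b = 0 | b = 1 /\ a = 0].
  move=> H e1 e2.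
  have [st|st|st] := H _ _ (unit_interval_bounds s) (unit_interval_bounds t) e1 e2.
  - by apply: Or31; exact: val_inj.
  - exact: Or32.
  - exact: Or33.
move=> a b /andP[a0 a1] /andP[b0 b1] e1 e2.
have [ab|ab] : a = b \/ a + b = 1.
  have /eqP : (a - b) * (a + b - 1) = 0 by nra.
  rewrite mulf_eq0 => /orP[] /eqP; [left|right]; lra.
- exact: Or31.
(* Opposite abscissas give opposite second coordinates; being also equal these vanish, so [a] is 1/2
   or an end of the interval. *)
move: e1; have -> : 1 - 2 * b = - (1 - 2 * a) by lra.
rewrite sqrrN mulrN mulNr => e1.
have /eqP : (1 - 2 * a) * Num.sqrt (1 - (1 - 2 * a) ^+ 2) = 0 by lra.
rewrite mulf_eq0 => /orP[/eqP a2|]; first by apply: Or31; lra.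
rewrite sqrtr_eq0 => a2.
have /eqP : a * (a - 1) = 0 by nra.
rewrite mulf_eq0 => /orP[] /eqP a3; [apply: Or33|apply: Or32]; split; lra.
Qed.

Lemma mapping_torus_id (X : topologicalType) :
  compact [set: X] -> hausdorff_space X ->
  homeomorphic (mapping_torus R (@id X)) (X * sphere R 1)%type.
Proof.
move=> cX hX.
apply: (@homeomorphic_mapping_torus _ _ _ _
  (fun p : X * I => (p.1, circle_point p.2))) => //.
- apply: hausdorff_prod => //; apply: hausdorff_set_type; exact: norm_hausdorff.
- apply: cont_pair; first by move=> p; exact: cvg_fst.
  move=> p; apply: continuous_comp; first exact: cvg_snd.
  exact: circle_point_continuous.
- by move=> [x u]; have [t <-] := circle_point_surj u; exists (x, t).
- move=> [x s] [y t] [/= s1 t0 ->]; congr pair; apply: val_inj => /=.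
  apply/rowP => i; rewrite !mxE s1 t0; case: ifP => _; first by ring.
  rewrite (_ : 1 - (1 - 2 * 1) ^+ 2 = 0); last by ring.
  rewrite (_ : 1 - (1 - 2 * 0) ^+ 2 = 0); last by ring.
  by rewrite sqrtr0 !mulr0.
- move=> [x s] [y t] /= [-> /= e].
  have [->|[? ?]|[? ?]] := circle_row_fiber e; first exact: Or31.
    exact: Or32.
  exact: Or33.
Qed.

End Circle.

(** * Vectors modulo the diagonal and positive scaling *)

Section Profile.
Variables (R : realType) (m : nat).
Implicit Types v : 'rV[R]_m.+1.

(** Each class of R^(m+2) modulo the diagonal has one representative vanishing at [ord0]; in this
    way R^(m+1) stands for the quotient. *)
Definition extend v (i : 'I_m.+2) : R :=
  if unlift ord0 i is Some j then v ord0 j else 0.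

(** The initial value 0 of the fold does not disturb the minimum, since 0 is the coordinate of
    [extend v] at [ord0]; likewise for [emax]. *)
Definition emin v : R := \big[Num.min/0]_i extend v i.
Definition emax v : R := \big[Num.max/0]_i extend v i.
(** The representative of the ray of a nonzero [v], modulo the diagonal, with minimum 0 and maximum
    1. *)
Definition profile v i : R := (extend v i - emin v) / (emax v - emin v).

Lemma extend0 v : extend v ord0 = 0.
Proof. by rewrite /extend unlift_none. Qed.

Lemma extend_lift v j : extend v (lift ord0 j) = v ord0 j.
Proof. by rewrite /extend liftK. Qed.

Lemma extendZ a v i : extend (a *: v) i = a * extend v i.
Proof. by rewrite /extend; case: unlift => [j|]; rewrite ?mxE ?mulr0. Qed.

Lemma emin_le v i : emin v <= extend v i.
Proof. exact: bigmin_le. Qed.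

Lemma emax_ge v i : extend v i <= emax v.
Proof. exact: le_bigmax. Qed.

Lemma emin_attained v : exists i, extend v i = emin v.
Proof.
have : emin v <= emin v by [].
rewrite {1}/emin => /bigmin_leP[e|[i _ e]].
  by exists ord0; apply/eqP; rewrite eq_le emin_le extend0 e.
by exists i; apply/eqP; rewrite eq_le emin_le e.
Qed.

Lemma emax_attained v : exists i, extend v i = emax v.
Proof.
have : emax v <= emax v by [].
rewrite {2}/emax => /bigmax_geP[e|[i _ e]].
  by exists ord0; apply/eqP; rewrite eq_le emax_ge extend0 e.
by exists i; apply/eqP; rewrite eq_le emax_ge e.
Qed.

(** Otherwise [extend v] would be constant, equal to its coordinate 0 at [ord0]. *)
Lemma extent_gt0 v : v != 0 -> 0 < emax v - emin v.
Proof.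
move=> v0; rewrite subr_gt0 ltNge; apply: contra v0 => le_v; apply/eqP/rowP => j.
have := emin_le v ord0; have := emax_ge v ord0.
have := emin_le v (lift ord0 j); have := emax_ge v (lift ord0 j).
by rewrite extend0 extend_lift mxE; lra.
Qed.

Lemma eminZ a v : 0 < a -> emin (a *: v) = a * emin v.
Proof.
move=> a0; have [i ei] := emin_attained v; have [j ej] := emin_attained (a *: v).
apply/eqP; rewrite eq_le -{1}ei -extendZ emin_le -ej extendZ ler_pM2l//.
exact: emin_le.
Qed.

Lemma emaxZ a v : 0 < a -> emax (a *: v) = a * emax v.
Proof.
move=> a0; have [i ei] := emax_attained v; have [j ej] := emax_attained (a *: v).
apply/eqP; rewrite eq_le -{2}ei -extendZ emax_ge -ej extendZ ler_pM2l//.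
by rewrite emax_ge.
Qed.

Lemma eminN v : emin (- v) = - emax v.
Proof.
have [i ei] := emax_attained v; have [j ej] := emin_attained (- v).
have N k : extend (- v) k = - extend v k by rewrite -scaleN1r extendZ mulN1r.
by apply/eqP; rewrite eq_le -{1}ei -N emin_le -ej N lerN2 emax_ge.
Qed.

Lemma emaxN v : emax (- v) = - emin v.
Proof. by rewrite -[v in RHS]opprK eminN opprK. Qed.

Lemma profileZ a v i : 0 < a -> profile (a *: v) i = profile v i.
Proof.
move=> a0; rewrite /profile eminZ// emaxZ// extendZ -!mulrBr invfM mulrACA.
by rewrite divff ?mul1r// gt_eqF.
Qed.

(** Negation exchanges the minimum and the maximum. *)
Lemma profileN v i : v != 0 -> profile (- v) i = 1 - profile v i.
Proof.
move=> /extent_gt0 v0; rewrite /profile eminN emaxN -scaleN1r extendZ.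
have -> : - emin v - - emax v = emax v - emin v by ring.
by field; rewrite gt_eqF.
Qed.

Lemma profile_ge0 v i : v != 0 -> 0 <= profile v i.
Proof.
by move=> /extent_gt0 v0; rewrite divr_ge0 ?subr_ge0 ?emin_le// -subr_ge0 ltW.
Qed.

Lemma profile_le1 v i : v != 0 -> profile v i <= 1.
Proof.
by move=> /extent_gt0 v0; rewrite ler_pdivrMr// mul1r lerD2r emax_ge.
Qed.

Lemma profile_eq0 v : exists i, profile v i = 0.
Proof.
have [i ei] := emin_attained v; exists i.
by rewrite /profile ei subrr mul0r.
Qed.

Lemma profile_eq1 v : v != 0 -> exists i, profile v i = 1.
Proof.
move=> /extent_gt0 v0; have [i ei] := emax_attained v.
by exists i; rewrite /profile ei divff// gt_eqF.
Qed.

(** Subtracting the value at [ord0] undoes the translation by the minimum, so a profile loses only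
    the scale of [v]. *)
Lemma profileK v j : v != 0 ->
  v ord0 j = (emax v - emin v) * (profile v (lift ord0 j) - profile v ord0).
Proof.
move=> /extent_gt0 v0; rewrite /profile extend0 extend_lift.
by field; rewrite gt_eqF.
Qed.

Lemma profile_inj v w : v != 0 -> w != 0 -> profile v =1 profile w ->
  exists2 a, 0 < a & v = a *: w.
Proof.
move=> v0 w0 e; have v1 := extent_gt0 v0; have w1 := extent_gt0 w0.
exists ((emax v - emin v) / (emax w - emin w)); first exact: divr_gt0.
apply/rowP => j; rewrite mxE (profileK _ v0) (profileK _ w0) !e.
by field; rewrite gt_eqF.
Qed.

Lemma profile_continuous (X : topologicalType) (F : X -> 'rV[R]_m.+1) i :
  (forall x, F x != 0) -> continuous F -> continuous (fun x => profile (F x) i).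
Proof.
move=> F0 cF.
have ce j : continuous (fun x => extend (F x) j).
  rewrite /extend; case: unlift => [k|]; last exact: cont_cst.
  exact: cont_coord.
have cmin : continuous (fun x => emin (F x)) by exact: cont_bigmin.
have cmax : continuous (fun x => emax (F x)) by exact: cont_bigmax.
apply: contM; first exact: contB.
by apply: contV; [move=> x; rewrite gt_eqF// extent_gt0|exact: contB].
Qed.

End Profile.

(** * Rotation of pairs of coordinates *)

Section Twist.
Variables (R : realType) (m : nat).
Implicit Types v : 'rV[R]_m.+1.

(* Multiplication by [a + b i] in consecutive pairs of coordinates, ending with
   the last one; when [m] is even the coordinate [0] is left over and fixed. *)
Definition twist (a b : R) v : 'rV[R]_m.+1 :=
  \row_i (if odd (i + m) then a * v ord0 i - b * v ord0 (inord i.+1)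
          else if i == ord0 then v ord0 i
          else a * v ord0 i + b * v ord0 (inord i.-1)).

(** This is the product of the complex numbers [a + b i] and [c + e i]. *)
Lemma twistM a b c e v :
  twist a b (twist c e v) = twist (a * c - b * e) (a * e + b * c) v.
Proof.
apply/rowP => i; rewrite !mxE.
have [oi|oi] := boolP (odd (i + m)).
  (* The last coordinate never opens a pair, because [m + m] is even; so [inord] does not fall back
     on its default. *)
  have im : (i.+1 < m.+1)%N.
    rewrite ltnS ltn_neqAle -ltnS ltn_ord andbT.
    by apply: contraL oi => /eqP ->; rewrite addnn odd_double.
  have i1 : inord i.+1 != ord0 :> 'I_m.+1 by rewrite -val_eqE /= inordK.
  rewrite inordK//= oi /= (negbTE i1).
  have -> : inord i = i :> 'I_m.+1 by rewrite inord_val.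
  by ring.
have [//|i0] := eqVneq i ord0.
have i1 : (0 < i)%N by rewrite lt0n.
have im : (i.-1 < m.+1)%N by rewrite (leq_ltn_trans (leq_pred _)).
have oi1 : odd (i.-1 + m) by move: oi; rewrite -{1}(prednK i1) addSn /= negbK.
rewrite inordK// oi1 prednK// inord_val.
by ring.
Qed.

Lemma twist1 v : twist 1 0 v = v.
Proof.
apply/rowP => i; rewrite !mxE !mul0r subr0 addr0 mul1r.
by case: odd => //; case: eqP.
Qed.

Lemma twistZ a b c v : twist a b (c *: v) = c *: twist a b v.
Proof.
apply/rowP => i; rewrite !mxE; case: odd; first by ring.
by case: eqP => _ //; ring.
Qed.

Lemma twist0 a b : twist a b 0 = 0.
Proof. by rewrite -[X in twist _ _ X](scale0r 0) twistZ scale0r. Qed.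

(** There are [m + 1] coordinates, an even number, so all of them are paired and change sign. *)
Lemma twistN1_odd v : odd m -> twist (-1) 0 v = - v.
Proof.
move=> om; apply/rowP => i; rewrite !mxE !mul0r subr0 addr0 mulN1r.
case: ifP => // oi; case: eqP => // i0.
by move: oi; rewrite i0 add0n om.
Qed.

(** Coordinate 0 is left unpaired and fixed, while all others change sign. *)
Lemma twistN1_even v : ~~ odd m -> twist (-1) 0 v = - reflect_row v.
Proof.
move=> om; apply/rowP => i; rewrite !mxE !mul0r subr0 addr0 mulN1r.
have [->|i0] := eqVneq i ord0; last by case: odd.
by rewrite add0n (negbTE om) opprK.
Qed.

(** The inner coefficients are those of the inverse of [a + b i]. *)
Lemma twistK a b v : a ^+ 2 + b ^+ 2 != 0 ->
  twist a b (twist (a / (a ^+ 2 + b ^+ 2)) (- b / (a ^+ 2 + b ^+ 2)) v) = v.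
Proof.
move=> ab; rewrite twistM -[RHS]twist1; congr twist; by field.
Qed.

Lemma twistVK a b v : a ^+ 2 + b ^+ 2 != 0 ->
  twist (a / (a ^+ 2 + b ^+ 2)) (- b / (a ^+ 2 + b ^+ 2)) (twist a b v) = v.
Proof.
move=> ab; rewrite twistM -[RHS]twist1; congr twist; by field.
Qed.

Lemma twist_continuous (X : topologicalType) (a b : X -> R)
    (F : X -> 'rV[R]_m.+1) :
  continuous a -> continuous b -> continuous F ->
  continuous (fun x => twist (a x) (b x) (F x)).
Proof.
move=> ca cb cF; apply: continuous_mx => k i; under eq_fun do rewrite mxE.
case: odd; first by apply: contB; apply: contM => //; exact: cont_coord.
case: (i == ord0); first exact: cont_coord.
by apply: contD; apply: contM => //; exact: cont_coord.
Qed.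

End Twist.

(** * Cutting a profile at a level and distributing it to the blocks *)

Local Notation j0 := (@Ordinal 3 0 isT).
Local Notation j1 := (@Ordinal 3 1 isT).
Local Notation j2 := (@Ordinal 3 2 isT).

Section Levels.
Variables (R : realType) (n : nat).
Implicit Types (y : 'I_n -> R) (t k c : R).

Definition pos (x : R) : R := Num.max 0 x.

Lemma pos_ge0 x : 0 <= pos x.
Proof. by rewrite /pos le_max lexx. Qed.

Lemma pos_id x : 0 <= x -> pos x = x.
Proof. exact: max_r. Qed.

Lemma pos_eq0 x : x <= 0 -> pos x = 0.
Proof. exact: max_l. Qed.

Lemma posBposN x : pos x - pos (- x) = x.
Proof.
have [x0|/ltW x0] := leP 0 x.
  by rewrite pos_id// pos_eq0 ?oppr_le0// subr0.
by rewrite pos_eq0// pos_id ?oppr_ge0// sub0r opprK.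
Qed.

Lemma pos_split x : (pos x != 0) -> pos (- x) = 0.
Proof.
move=> x0; apply: pos_eq0; rewrite oppr_le0 leNgt; apply: contra x0 => x0.
by rewrite pos_eq0// ltW.
Qed.

Lemma posM c x : 0 <= c -> pos (c * x) = c * pos x.
Proof. by move=> c0; rewrite /pos maxr_pMr// mulr0. Qed.

Lemma pos_continuous (X : topologicalType) (f : X -> R) :
  continuous f -> continuous (fun x => pos (f x)).
Proof. by move=> cf; apply: cont_max => //; exact: cont_cst. Qed.

(* The three rows are the weights of the vertex blocks.  As [t] runs through
   [0, 1/3], [1/3, 2/3], [2/3, 1] the cutting level goes from 0 to 1, back to 0
   and again to 1; the parts of [y] above and below it go to the blocks 0 and 1,
   then 2 and 1, then 2 and 0 (see [stage]). *)
Definition weight y t (j : 'I_3) (i : 'I_n) : R :=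
  if j == j0 then
    pos (y i - Num.min (3 * t) 1) + pos (Num.max 0 (3 * t - 2) - y i)
  else if j == j1 then pos (Num.max 0 (1 - `|3 * t - 1|) - y i)
  else pos (y i - Num.min 1 `|3 * t - 2|).

(** The form of [weight] during one stage, with the upper block [a] and the lower block [b] made
    explicit. *)
Definition level_cut y k (a b j : 'I_3) (i : 'I_n) : R :=
  if j == a then pos (y i - k) else if j == b then pos (k - y i) else 0.

(** At level 1 the upper block is empty and can be replaced, at level 0 the lower one; hence the
    zigzag, and consecutive stages agree at [3 t = 1] and [3 t = 2]. *)
Definition stage t k (a b : 'I_3) : Prop :=
  [\/ [/\ 0 <= 3 * t <= 1, k = 3 * t, a = j0 & b = j1],
      [/\ 1 <= 3 * t <= 2, k = 2 - 3 * t, a = j2 & b = j1]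
    | [/\ 2 <= 3 * t <= 3, k = 3 * t - 2, a = j2 & b = j0]].

Definition normalized y : Prop :=
  [/\ forall i, 0 <= y i <= 1, exists i, y i = 0 & exists i, y i = 1].

Lemma stage_exists t : 0 <= t <= 1 -> exists k a b, stage t k a b.
Proof.
case/andP => t0 t1; have [h1|h1] := leP (3 * t) 1.
  by exists (3 * t), j0, j1; apply: Or31; split=> //; apply/andP; split; lra.
have [h2|h2] := leP (3 * t) 2.
  exists (2 - 3 * t), j2, j1; apply: Or32; split=> //.
  by apply/andP; split; lra.
by exists (3 * t - 2), j2, j0; apply: Or33; split=> //; apply/andP; split; lra.
Qed.

Lemma stage_neq t k a b : stage t k a b -> a != b.
Proof. by case=> -[_ _ -> ->]. Qed.

Lemma stage_level t k a b : stage t k a b -> 0 <= k <= 1.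
Proof.
by case=> -[/andP[? ?] -> _ _]; apply/andP; split; lra.
Qed.

Lemma ord3_cases (j : 'I_3) : [\/ j = j0, j = j1 | j = j2].
Proof.
by case: j => -[|[|[|//]]] i; [apply: Or31|apply: Or32|apply: Or33];
  apply: val_inj.
Qed.

(** Links the closed min-max formula, which makes continuity immediate, to the stagewise form in
    which the combinatorics is visible. *)
Lemma weight_stage y t k a b : (forall i, 0 <= y i <= 1) -> stage t k a b ->
  weight y t =2 level_cut y k a b.
Proof.
move=> y01 st j i; have /andP[y0 y1] := y01 i; rewrite /weight /level_cut.
case: st => -[/andP[t0 t1] -> -> ->]; have [->|->|->] := ord3_cases j => /=.
- rewrite min_l ?max_l; [|lra..].
  by rewrite [X in _ + X]pos_eq0 ?addr0//; lra.
- rewrite ler0_norm; last by lra.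
  by rewrite max_r; [congr pos; lra|lra].
- rewrite ler0_norm; last by lra.
  by rewrite min_l ?pos_eq0//; lra.
- rewrite min_r ?max_l; [|lra..].
  by rewrite !pos_eq0 ?addr0//; lra.
- rewrite ger0_norm; last by lra.
  by rewrite max_r; [congr pos; lra|lra].
- rewrite ler0_norm; last by lra.
  by rewrite min_r; [congr pos; lra|lra].
- rewrite min_r ?max_r; [|lra..].
  by rewrite [X in X + _]pos_eq0 ?add0r//; lra.
- rewrite ger0_norm; last by lra.
  by rewrite max_l ?pos_eq0//; lra.
- rewrite ger0_norm; last by lra.
  by rewrite min_r; [congr pos; lra|lra].
Qed.

(** Nonnegative matrices whose support is a face of [BM]: the last three conditions mirror those on
    faces, and the total weight is left free. *)
Definition face_weights (M : 'I_3 -> 'I_n -> R) : Prop :=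
  [/\ forall j i, 0 <= M j i,
      forall i j j', M j i != 0 -> M j' i != 0 -> j = j',
      exists j, forall i, M j i = 0
    & forall j, exists i, M j i = 0].

(** The parts above and below the level have disjoint supports. The upper part vanishes where [y] is
    0 and the lower part where [y] is 1, so neither fills its block. *)
Lemma level_cut_face_weights y k a b : normalized y -> a != b -> 0 <= k <= 1 ->
  face_weights (level_cut y k a b).
Proof.
move=> [y01 [i yi0] [i' yi1]] ab /andP[k0 k1]; split.
- by move=> j l; rewrite /level_cut; case: eqP => // _; [|case: eqP => // _];
    exact: pos_ge0.
- have ne l : pos (y l - k) != 0 -> pos (k - y l) != 0 -> False.
    by move=> /pos_split; rewrite opprB => ->; rewrite eqxx.
  move=> l j j'; rewrite /level_cut.
  case: (eqVneq j a) => [->|_]; case: (eqVneq j' a) => [->|_] //.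
  + by case: ifP => [_|_]; [move=> h1 h2; case: (ne _ h1 h2)|rewrite eqxx].
  + by case: ifP => [_|_]; [move=> h1 h2; case: (ne _ h2 h1)|rewrite eqxx].
  + case: (eqVneq j b) => [->|_]; case: (eqVneq j' b) => [->|_] //;
    by rewrite eqxx.
- have [c ca cb] : exists2 c : 'I_3, c != a & c != b.
    have [->|->|->] := ord3_cases a; have [->|->|->] := ord3_cases b;
    solve [by exists j0|by exists j1|by exists j2].
  by exists c => l; rewrite /level_cut (negbTE ca) (negbTE cb).
- move=> j; rewrite /level_cut; case: eqP => _.
    by exists i; rewrite yi0 pos_eq0//; lra.
  case: eqP => _; last by exists i.
  by exists i'; rewrite yi1 pos_eq0//; lra.
Qed.

(** The maximum of each block for a normalized profile. The maxima do not depend on the profile and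
    sum to 1, so they reveal both the scale and the level. *)
Definition level_max k (a b j : 'I_3) : R :=
  if j == a then 1 - k else if j == b then k else 0.

Lemma sum_level_max k a b : a != b -> \sum_j level_max k a b j = 1.
Proof.
move=> ab; rewrite (bigD1 a)//= (bigD1 b) 1?eq_sym//= big1 => [|j]; last first.
  by rewrite /level_max => /andP[/negbTE -> /negbTE ->].
by rewrite /level_max !eqxx eq_sym (negbTE ab) addr0 subrK.
Qed.

Lemma level_cut_le_max y k a b j i : (forall i, 0 <= y i <= 1) -> 0 <= k <= 1 ->
  level_cut y k a b j i <= level_max k a b j.
Proof.
move=> y01 /andP[k0 k1]; have /andP[y0 y1] := y01 i.
rewrite /level_cut /level_max.
by case: eqP => _; [|case: eqP => _ //]; rewrite /pos ge_max; apply/andP; split;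
  lra.
Qed.

Lemma level_cut_max y k a b j : normalized y -> 0 <= k <= 1 ->
  exists i, level_cut y k a b j i = level_max k a b j.
Proof.
move=> [_ [i yi0] [i' yi1]] /andP[k0 k1]; rewrite /level_cut /level_max.
case: eqP => _; first by exists i'; rewrite yi1 pos_id//; lra.
by case: eqP => _; exists i => //; rewrite yi0 subr0 pos_id.
Qed.

(** The block maxima scale by [c] as well, and they sum to 1 on both sides. *)
Lemma level_cut_scale y k a b y' k' a' b' c :
  normalized y -> 0 <= k <= 1 -> a != b ->
  normalized y' -> 0 <= k' <= 1 -> a' != b' -> 0 < c ->
  (forall j i, level_cut y k a b j i = c * level_cut y' k' a' b' j i) ->
  c = 1 /\ level_max k a b =1 level_max k' a' b'.
Proof.
move=> ny kk ab ny' kk' ab' c0 e.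
have lm j : level_max k a b j = c * level_max k' a' b' j.
  have [i ei] := level_cut_max a b j ny kk.
  have [i' ei'] := level_cut_max a' b' j ny' kk'.
  have [y01 _ _] := ny; have [y01' _ _] := ny'.
  apply/eqP; rewrite eq_le -{1}ei e ler_pM2l// level_cut_le_max//=.
  by rewrite -ei' -e level_cut_le_max.
have c1 : c = 1.
  rewrite -(sum_level_max k ab) (eq_bigr _ (fun j _ => lm j)) -mulr_sumr.
  by rewrite sum_level_max// mulr1.
by split=> // j; rewrite lm c1 mul1r.
Qed.

(** As [t] runs from 0 to 1, the triple of block maxima runs once around the boundary of the
    standard triangle, starting and ending at the vertex of block 0. *)
Lemma stage_inj t k a b t' k' a' b' : stage t k a b -> stage t' k' a' b' ->
  level_max k a b =1 level_max k' a' b' ->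
  [\/ t = t', t = 1 /\ t' = 0 | t' = 1 /\ t = 0].
Proof.
move=> st st' lm; have := lm j0; have := lm j1; have := lm j2.
rewrite /level_max.
by case: st => -[/andP[? ?] -> -> ->]; case: st' => -[/andP[? ?] -> -> ->] /=;
  move=> ? ? ?; solve [apply: Or31; lra|apply: Or32; split; lra
                      |apply: Or33; split; lra].
Qed.

(** [y - k] is the difference of its positive and negative parts, which blocks [a] and [b]
    record. *)
Lemma level_cut_inj y y' k a b : a != b ->
  level_cut y k a b =2 level_cut y' k a b -> y =1 y'.
Proof.
move=> ab e i; have := e a i; have := e b i.
rewrite /level_cut !eqxx eq_sym (negbTE ab) => e1 e2.
apply: (addIr (- k)); rewrite -[LHS]posBposN -[RHS]posBposN !opprB.
by rewrite e1 e2.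
Qed.

Lemma weight_start y i : (forall i, 0 <= y i <= 1) -> weight y 0 j0 i = y i.
Proof.
move=> y01; have st : stage 0 0 j0 j1.
  by apply: Or31; split=> //; [apply/andP; split; lra|lra].
rewrite (weight_stage y01 st) /level_cut eqxx subr0 pos_id//.
by have /andP[] := y01 i.
Qed.

(** At level 1 the whole profile lies below the cut and goes to block 0 as its complement, whereas
    at the start block 0 holds [y] itself; this is the source of the antipodal gluing. *)
Lemma weight_end y i : (forall i, 0 <= y i <= 1) -> weight y 1 j0 i = 1 - y i.
Proof.
move=> y01; have st : stage 1 1 j2 j0.
  by apply: Or33; split=> //; [apply/andP; split; lra|lra].
rewrite (weight_stage y01 st) /level_cut /= pos_id//.
by have /andP[] := y01 i; lra.
Qed.

Lemma weight_ends y t j i : (forall i, 0 <= y i <= 1) -> t = 0 \/ t = 1 ->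
  j != j0 -> weight y t j i = 0.
Proof.
move=> y01; have /andP[y0 y1] := y01 i.
case=> -> jn0; have [j_|j_|j_] := ord3_cases j; rewrite j_ in jn0 * => //.
- have st : stage 0 0 j0 j1.
    by apply: Or31; split=> //; [apply/andP; split; lra|lra].
  by rewrite (weight_stage y01 st) /level_cut /= pos_eq0//; lra.
- have st : stage 0 0 j0 j1.
    by apply: Or31; split=> //; [apply/andP; split; lra|lra].
  by rewrite (weight_stage y01 st).
- have st : stage 1 1 j2 j0.
    by apply: Or33; split=> //; [apply/andP; split; lra|lra].
  by rewrite (weight_stage y01 st).
- have st : stage 1 1 j2 j0.
    by apply: Or33; split=> //; [apply/andP; split; lra|lra].
  by rewrite (weight_stage y01 st) /level_cut /= pos_eq0//; lra.
Qed.

Lemma weight_face_weights y t : normalized y -> 0 <= t <= 1 ->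
  face_weights (weight y t).
Proof.
move=> ny t01; have [k [a [b st]]] := stage_exists t01; have [y01 _ _] := ny.
have -> : weight y t = level_cut y k a b.
  by apply/funext => j; apply/funext => i; exact: weight_stage.
by apply: level_cut_face_weights => //;
  [exact: stage_neq st|exact: stage_level st].
Qed.

(** The block maxima alone already sum to 1. *)
Lemma weight_sum_gt0 y t : normalized y -> 0 <= t <= 1 ->
  0 < \sum_j \sum_i weight y t j i.
Proof.
move=> ny t01; have [k [a [b st]]] := stage_exists t01; have [y01 _ _] := ny.
have k01 := stage_level st.
apply: lt_le_trans ltr01 _.
rewrite -(sum_level_max k (stage_neq st)); apply: ler_sum => j _.
have [i <-] := level_cut_max a b j ny k01; rewrite -(weight_stage y01 st).
rewrite (bigD1 i)//= lerDl; apply: sumr_ge0 => l _.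
by have [] := weight_face_weights ny t01.
Qed.

(** The block maxima remove the scale and give the time up to exchange of the ends. The profile is
    then read off at the common level, or on block 0 at the ends. *)
Lemma weight_fiber y y' t t' c : normalized y -> normalized y' ->
  0 <= t <= 1 -> 0 <= t' <= 1 -> 0 < c ->
  (forall j i, weight y t j i = c * weight y' t' j i) ->
  [\/ t = t' /\ y =1 y',
      [/\ t = 1, t' = 0 & forall i, y' i = 1 - y i]
    | [/\ t' = 1, t = 0 & forall i, y i = 1 - y' i]].
Proof.
move=> ny ny' t01 t01' c0 e.
have [k [a [b st]]] := stage_exists t01; have [y01 _ _] := ny.
have [k' [a' [b' st']]] := stage_exists t01'; have [y01' _ _] := ny'.
have [c1 lm] := level_cut_scale ny (stage_level st) (stage_neq st) ny'
  (stage_level st') (stage_neq st') c0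
  (fun j i => etrans (esym (weight_stage y01 st j i))
    (etrans (e j i) (congr1 _ (weight_stage y01' st' j i)))).
have e' j i : weight y t j i = weight y' t' j i by rewrite e c1 mul1r.
have [tt'|[t1 t0]|[t1 t0]] := stage_inj st st' lm.
- apply: Or31; split=> //.
  apply: (level_cut_inj (k := k) (stage_neq st)) => j i.
  by rewrite -!(weight_stage _ st)// e' tt'.
- apply: Or32; split=> // i.
  by have := e' j0 i; rewrite t1 t0 weight_start// weight_end// => <-.
- apply: Or33; split=> // i.
  by have := e' j0 i; rewrite t1 t0 weight_start// weight_end// => ->.
Qed.

Lemma weight_continuous (X : topologicalType) (Y : X -> 'I_n -> R) (T : X -> R)
    j i :
  (forall i, continuous (fun x => Y x i)) -> continuous T ->
  continuous (fun x => weight (Y x) (T x) j i).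
Proof.
move=> cY cT; rewrite /weight.
have c3 : continuous (fun x => 3 * T x).
  by apply: contM => //; exact: cont_cst.
have c3B (a : R) : continuous (fun x => 3 * T x - a).
  by apply: contB => //; exact: cont_cst.
case: (j == j0); [apply: contD|case: (j == j1)]; apply: pos_continuous;
  apply: contB => //.
- by apply: cont_min => //; exact: cont_cst.
- by apply: cont_max => //; exact: cont_cst.
- apply: cont_max; first exact: cont_cst.
  by apply: contB; [exact: cont_cst|exact: cont_norm].
- by apply: cont_min; [exact: cont_cst|exact: cont_norm].
Qed.

End Levels.

(** With one block empty, the matrix consists of the positive and negative parts of a single vector
    [w], the difference of the other two rows. Up to translation and scale [w] is a profile, and the
    translation is the level of the cut. *)
Lemma weight_surj (R : realType) (m : nat) (M : 'I_3 -> 'I_m.+2 -> R) :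
  face_weights M -> (exists j i, M j i != 0) ->
  exists v t c, [/\ v != 0, 0 <= t <= 1, 0 < c
    & forall j i, M j i = c * weight (@profile R m v) t j i].
Proof.
move=> [M0 Mcol [k Mk] Mrow] [j' [i' Mj'i']].
(* The empty block [k] selects the stage; the time comes from solving its equation for the level. *)
have [a [b [ab abk stages]]] : exists a b, [/\ a != b,
    forall j, [\/ j = a, j = b | j = k]
    & forall l : R, 0 <= l <= 1 -> exists2 t, 0 <= t <= 1 & stage t l a b].
  have [k_|k_|k_] := ord3_cases k.
  - exists j2, j1; split=> //.
      move=> j; rewrite k_.
      by have [->|->|->] := ord3_cases j; [apply: Or33|apply: Or32|apply: Or31].
    move=> l /andP[l0 l1]; exists ((2 - l) / 3).
      by apply/andP; split; lra.
    by apply: Or32; split=> //; [apply/andP; split; lra|lra].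
  - exists j2, j0; split=> //.
      move=> j; rewrite k_.
      by have [->|->|->] := ord3_cases j; [apply: Or32|apply: Or33|apply: Or31].
    move=> l /andP[l0 l1]; exists ((2 + l) / 3).
      by apply/andP; split; lra.
    by apply: Or33; split=> //; [apply/andP; split; lra|lra].
  - exists j0, j1; split=> //.
      move=> j; rewrite k_.
      by have [->|->|->] := ord3_cases j; [apply: Or31|apply: Or32|apply: Or33].
    move=> l /andP[l0 l1]; exists (l / 3); first by apply/andP; split; lra.
    by apply: Or31; split=> //; [apply/andP; split; lra|lra].
pose w i := M a i - M b i.
have disj i : M a i = 0 \/ M b i = 0.
  have [|Ma] := eqVneq (M a i) 0; first by left.
  have [|Mb] := eqVneq (M b i) 0; first by right.
  by have := Mcol _ _ _ Ma Mb; move: ab => /eqP.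
have Ma i : M a i = pos (w i).
  have := M0 a i; have := M0 b i; rewrite /w.
  by case: (disj i) => -> ? ?; [rewrite pos_eq0//|rewrite pos_id//]; lra.
have Mb i : M b i = pos (- w i).
  have := M0 a i; have := M0 b i; rewrite /w.
  by case: (disj i) => -> ? ?; [rewrite pos_id//|rewrite pos_eq0//]; lra.
(* No block is full, so [w] takes values of both signs in the weak sense; this will place the level
   in [0, 1]. *)
have [ia wia] : exists i, w i <= 0.
  by have [i Mai] := Mrow a; exists i; have := M0 b i; rewrite /w Mai; lra.
have [ib wib] : exists i, 0 <= w i.
  by have [i Mbi] := Mrow b; exists i; have := M0 a i; rewrite /w Mbi; lra.
pose v : 'rV[R]_m.+1 := \row_j (w (lift ord0 j) - w ord0).
have vE i : extend v i = w i - w ord0.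
  rewrite /extend; case: unliftP => [j|] ->; last by rewrite subrr.
  by rewrite mxE.
have v0 : v != 0.
  apply: contraNneq Mj'i' => v0.
  have w0 i : w i = w ord0.
    by apply/eqP; rewrite -subr_eq0 -vE v0 -(scale0r v) extendZ mul0r.
  have w00 i : w i = 0 by move: wia wib; rewrite !w0; lra.
  have [->|->|->] := abk j'; last by rewrite Mk.
    by rewrite Ma w00 pos_eq0.
  by rewrite Mb w00 oppr0 pos_eq0.
have c0 := extent_gt0 v0; set c := emax v - emin v in c0; have c0W := ltW c0.
(* The height on the profile at which [w] vanishes. *)
pose l := - (w ord0 + emin v) / c.
have wE i : w i = c * (profile v i - l).
  by rewrite /profile vE /l -/c; field; rewrite gt_eqF.
have l01 : 0 <= l <= 1.
  apply/andP; split.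
    have : profile v ia - l <= 0 by rewrite -(pmulr_rle0 _ c0) -wE.
    by have := profile_ge0 ia v0; lra.
  have : 0 <= profile v ib - l by rewrite -(pmulr_rge0 _ c0) -wE.
  by have := profile_le1 ib v0; lra.
have [t t01 st] := stages _ l01; exists v, t, c; split=> // j i.
have y01 i1 : 0 <= profile v i1 <= 1 by rewrite profile_ge0 ?profile_le1.
rewrite (weight_stage y01 st) /level_cut.
have [j_|jna] := eqVneq j a; first by rewrite j_ Ma wE posM.
have [j_|jnb] := eqVneq j b.
  by rewrite j_ Mb wE -mulrN opprB posM.
have [j_|j_|->] := abk j; last by rewrite Mk mulr0.
  by rewrite j_ eqxx in jna.
by rewrite j_ eqxx in jnb.
Qed.

(** * The complex and its coloring *)

Lemma mxvec_index_inj (m n : nat) (j j' : 'I_m) (i i' : 'I_n) :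
  mxvec_index j i = mxvec_index j' i' -> j = j' /\ i = i'.
Proof.
have [g gK _] := curry_mxvec_bij m n => e.
have := gK (j, i) isT; rewrite /= e (gK (j', i') isT) => -[-> ->].
by [].
Qed.

(* Vertex [mxvec_index j i] has color [i] and lies in block [j]; the facets are
   the transversals of the colors that meet exactly two of the three blocks. *)
Definition BM (n : nat) : {set {set 'I_(3 * n)}} :=
  [set s : {set 'I_(3 * n)} |
    [&& [forall i, forall j, forall j', (mxvec_index j i \in s) ==>
          (mxvec_index j' i \in s) ==> (j == j')],
        [exists j, forall i, mxvec_index j i \notin s]
      & [forall j, exists i, mxvec_index j i \notin s]]]%SET.

Lemma BMP (n : nat) (s : {set 'I_(3 * n)}) :
  reflect [/\ forall i j j', mxvec_index j i \in s -> mxvec_index j' i \in s ->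
                j = j',
              exists j, forall i, mxvec_index j i \notin s
            & forall j, exists i, mxvec_index j i \notin s]
          (s \in BM n).
Proof.
rewrite inE; apply: (iffP and3P) => -[h1 h2 h3]; split.
- move=> i j j' ji j'i; move/forallP: h1 => /(_ i)/forallP/(_ j)/forallP/(_ j').
  by rewrite ji j'i => /eqP.
- by move/existsP: h2 => [j /forallP]; exists j.
- by move/forallP: h3 => h3 j; have /existsP := h3 j.
- apply/forallP => i; apply/forallP => j; apply/forallP => j'.
  by apply/implyP => ji; apply/implyP => j'i; apply/eqP; exact: h1 ji j'i.
- by apply/existsP; have [j hj] := h2; exists j; apply/forallP.
- by apply/forallP => j; apply/existsP; exact: h3.
Qed.

Lemma BM_simplicial (n : nat) : simplicial_complex (BM n.+2).
Proof.
split.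
- apply/BMP; split=> [i j j'|| j]; rewrite ?inE//.
    by exists j0 => i; rewrite inE.
  by exists ord0; rewrite inE.
- move=> v; apply/BMP; case/mxvec_indexP: v => k l; split=> [i j j'||j].
  + by rewrite !inE => /eqP/mxvec_index_inj[-> _] /eqP/mxvec_index_inj[-> _].
  + have [k' k'k] : exists k' : 'I_3, k' != k.
      by have [->|->|->] := ord3_cases k; [exists j1|exists j0|exists j0].
    exists k' => i; rewrite inE; apply: contra k'k => /eqP/mxvec_index_inj[-> _].
    by [].
  (* With at least two colors, a single vertex does not fill its block. *)
  + have [l' l'l] : exists l' : 'I_n.+2, l' != l.
      have [->|l0] := eqVneq l ord0; first by exists ord_max.
      by exists ord0; rewrite eq_sym.
    exists l'; rewrite inE; apply: contra l'l => /eqP/mxvec_index_inj[_ ->].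
    by [].
- move=> s t /BMP[h1 [j hj] h3] /fintype.subsetP ts; apply/BMP; split.
  + by move=> i k k' /ts ks /ts k's; exact: h1 ks k's.
  + by exists j => i; apply: contra (hj i); exact: ts.
  + by move=> k; have [i hi] := h3 k; exists i; apply: contra hi; exact: ts.
Qed.

Lemma BM_balanced (n : nat) : balanced n.+2 (BM n.+2).
Proof.
have [g gK gK'] := curry_mxvec_bij 3 n.+2.
pose color (v : 'I_(3 * n.+2)) : 'I_n.+2 := (g v).2.
have colorE j i : color (mxvec_index j i) = i.
  by rewrite /color -[mxvec_index j i]/(uncurry (@mxvec_index 3 n.+2) (j, i)) gK.
have proper : proper_coloring (BM n.+2) color.
  move=> s /BMP[h1 _ _] u v; case/mxvec_indexP: u => j i.
  case/mxvec_indexP: v => j' i' us vs; rewrite !colorE => ii'.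
  by rewrite ii' in us *; rewrite (h1 _ _ _ us vs).
split; last by exists color.
(* A facet with one vertex of each color: color 0 in block 0, all others in block 1. *)
pose f (i : 'I_n.+2) : 'I_(3 * n.+2) :=
  mxvec_index (if i == ord0 then j0 else j1) i.
have finj : injective f by move=> i i' /mxvec_index_inj[].
have fP j i : (mxvec_index j i \in [set f i | i in 'I_n.+2]%SET) =
    (j == (if i == ord0 then j0 else j1)).
  apply/imsetP/eqP => [[i' _ /mxvec_index_inj[-> ->]]//|->].
  by exists i.
apply/eqP; rewrite eqn_leq; apply/andP; split.
  (* A proper coloring is injective on each face. *)
  apply/bigmax_leqP => s sBM; rewrite -[X in (_ <= X)%N]card_ord.
  rewrite -(card_in_imset (f := color)); first exact: max_card.
  by move=> u v us vs; exact: proper us vs.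
rewrite -[X in (X <= _)%N]card_ord -(card_imset _ finj).
apply: (@bigop.leq_bigmax_cond _ (mem (BM n.+2)) (fun s => #|s|)).
apply/BMP; split.
- by move=> i j j'; rewrite !fP => /eqP -> /eqP ->.
- by exists j2 => i; rewrite fP; case: ifP.
- move=> j; have [->|jn0] := eqVneq j j0; first by exists ord_max; rewrite fP.
  by exists ord0; rewrite fP eqxx.
Qed.

(** * Points of the realization as weight matrices *)

Section Realization.
Variables (R : realType) (n : nat).

Lemma sum_mxvec_index (F : 'I_(3 * n) -> R) :
  \sum_k F k = \sum_j \sum_i F (mxvec_index j i).
Proof.
rewrite pair_bigA /= (reindex (uncurry (@mxvec_index 3 n))) /=; last first.
  exact: curry_mxvec_bij.
by apply: eq_bigr => -[].
Qed.

Lemma realization_setP (x : 'rV[R]_(3 * n)) :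
  realization_set R (BM n) x <->
  face_weights (fun j i => x ord0 (mxvec_index j i)) /\
  \sum_j \sum_i x ord0 (mxvec_index j i) = 1.
Proof.
rewrite -sum_mxvec_index; split=> [[x0 x1 /BMP[h1 h2 h3]]|[[x0 h1 h2 h3] x1]].
  split=> //; split.
  - by move=> j i; exact: x0.
  - by move=> i j j' hj hj'; apply: (h1 i); rewrite inE.
  - by have [j hj] := h2; exists j => i; have := hj i; rewrite inE negbK => /eqP.
  - by move=> j; have [i hi] := h3 j; exists i; move: hi; rewrite inE negbK => /eqP.
split=> //; first by move=> k; case/mxvec_indexP: k => j i; exact: x0.
apply/BMP; split.
- by move=> i j j'; rewrite !inE; exact: h1.
- by have [j hj] := h2; exists j => i; rewrite inE hj eqxx.
- by move=> j; have [i hi] := h3 j; exists i; rewrite inE hi eqxx.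
Qed.

End Realization.

(** * The realization as a mapping torus *)

Section Parametrization.
Variables (R : realType) (m : nat).
Local Notation I := (set_type (@unit_interval R)).
Local Notation K := (sphere R m * I)%type.
Local Notation B := (realization R (BM m.+2)).
Implicit Types (v : 'rV[R]_m.+1) (t : R).

(** The factor [(1 - 2 t) + t (1 - t) i] follows a path from 1 to -1 that avoids 0. Its modulus need
    not be 1, because profiles ignore positive scaling. *)
Definition turn v t : 'rV[R]_m.+1 := twist (1 - 2 * t) (t * (1 - t)) v.

Lemma turn_unit t : (1 - 2 * t) ^+ 2 + (t * (1 - t)) ^+ 2 != 0.
Proof.
apply/negP; rewrite paddr_eq0 ?sqr_ge0// !sqrf_eq0 => /andP[/eqP h].
by rewrite mulf_eq0 => /orP[] /eqP; lra.
Qed.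

Lemma turn_neq0 v t : v != 0 -> turn v t != 0.
Proof.
apply: contraNneq => e; rewrite -(twistVK v (turn_unit t)) -/(turn v t) e.
by rewrite twist0.
Qed.

Lemma turn0 v : turn v 0 = v.
Proof. by rewrite /turn mulr0 subr0 mul0r twist1. Qed.

Lemma turn1 v : turn v 1 = twist (-1) 0 v.
Proof. by rewrite /turn subrr mulr0; congr twist; ring. Qed.

Lemma sphere_scale (u u' : sphere R m) (a : R) :
  0 < a -> set_val u = a *: set_val u' -> u = u'.
Proof.
move=> a0 e; apply: val_inj => /=.
have := sqn_sphere u; rewrite e sqnZ sqn_sphere mulr1 => /eqP.
rewrite sqrf_eq1 => /orP[] /eqP a1; last first.
  by move: a0; rewrite a1 oppr_gt0 ltr10.
by rewrite -[LHS]/(set_val u) e a1 scale1r.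
Qed.

Lemma profile_normalized v : v != 0 -> normalized (profile v).
Proof.
move=> v0; split; first by move=> i; rewrite profile_ge0 ?profile_le1.
  exact: profile_eq0.
exact: profile_eq1.
Qed.

Definition mass v t : R := \sum_j \sum_i weight (profile v) t j i.

Definition param_row v t : 'rV[R]_(3 * m.+2) :=
  mxvec (\matrix_(j, i) (weight (profile v) t j i / mass v t)).

Lemma param_rowE v t j i :
  param_row v t ord0 (mxvec_index j i) = weight (profile v) t j i / mass v t.
Proof. by rewrite mxvecE mxE. Qed.

Lemma param_row_realization v t : v != 0 -> 0 <= t <= 1 ->
  param_row v t \in realization_set R (BM m.+2).
Proof.
move=> v0 t01; have ny := profile_normalized v0.
have N0 : 0 < mass v t by exact: weight_sum_gt0.
have [W0 Wcol [k Wk] Wrow] := weight_face_weights ny t01.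
apply/mem_set/realization_setP; split.
  split.
  - by move=> j i; rewrite param_rowE divr_ge0// ltW.
  - move=> i j j'; rewrite !param_rowE !mulf_eq0 !negb_or => /andP[h _] /andP[h' _].
    exact: Wcol h h'.
  - by exists k => i; rewrite param_rowE Wk mul0r.
  - by move=> j; have [i hi] := Wrow j; exists i; rewrite param_rowE hi mul0r.
under eq_bigr do (under eq_bigr do rewrite param_rowE; rewrite -mulr_suml).
by rewrite -mulr_suml divff// gt_eqF.
Qed.

Lemma param_realization (p : K) :
  param_row (turn (set_val p.1) (set_val p.2)) (set_val p.2)
    \in realization_set R (BM m.+2).
Proof.
apply: param_row_realization; last exact: unit_interval_bounds.
by apply: turn_neq0; exact: sphere_neq0.
Qed.

Definition param (p : K) : B := SigSub (param_realization p).

Lemma param_val p :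
  set_val (param p) = param_row (turn (set_val p.1) (set_val p.2)) (set_val p.2).
Proof. by []. Qed.

Lemma param_continuous : continuous param.
Proof.
have ct : continuous (fun p : K => set_val p.2 : R).
  move=> p; apply: continuous_comp; first exact: cvg_snd.
  exact: set_val_continuous.
have cu : continuous (fun p : K => set_val p.1 : 'rV[R]_m.+1).
  move=> p; apply: continuous_comp; first exact: cvg_fst.
  exact: set_val_continuous.
have cturn : continuous (fun p : K => turn (set_val p.1) (set_val p.2)).
  have c1 : continuous (fun p : K => 1 - (set_val p.2 : R)).
    by apply: contB => //; exact: cont_cst.
  apply: twist_continuous => //; last exact: contM.
  by apply: contB; [exact: cont_cst|apply: contM => //; exact: cont_cst].
have turn0 (p : K) : turn (set_val p.1) (set_val p.2) != 0.
  by apply: turn_neq0; exact: sphere_neq0.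
have cw j i : continuous (fun p : K =>
    weight (profile (turn (set_val p.1) (set_val p.2))) (set_val p.2) j i).
  apply: (weight_continuous (Y := fun p => profile (turn (set_val p.1) _))) => //.
  by move=> l; exact: profile_continuous.
apply: continuous_set_val; apply: continuous_mx => o k; rewrite (ord1 o).
case/mxvec_indexP: k => j i.
rewrite (_ : (fun _ => _) = fun p => weight
    (profile (turn (set_val p.1) (set_val p.2))) (set_val p.2) j i /
  mass (turn (set_val p.1) (set_val p.2)) (set_val p.2)); last first.
  by apply/funext => p; exact: param_rowE.
apply: contM => //; apply: contV => [p|].
  rewrite gt_eqF//; apply: weight_sum_gt0; last exact: unit_interval_bounds.
  exact: profile_normalized.
by apply: cont_sum => j'; apply: cont_sum.
Qed.

Lemma param_surj b : exists p, param p = b.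
Proof.
have /realization_setP[face sum1] := set_valP b.
have nz : exists j i, set_val b ord0 (mxvec_index j i) != 0.
  apply: contrapT => h; have := sum1; rewrite big1 => [/esym/eqP|j _].
    by rewrite oner_eq0.
  rewrite big1// => i _; apply/eqP; apply: contrapT => /negP bji.
  by apply: h; exists j, i.
have [v [t [c [v0 t01 c0 bE]]]] := weight_surj face nz.
pose s := (1 - 2 * t) ^+ 2 + (t * (1 - t)) ^+ 2.
(* Division by the complex factor of [turn] at time [t]. *)
pose w : 'rV[R]_m.+1 := twist ((1 - 2 * t) / s) (- (t * (1 - t)) / s) v.
have w_v : turn w t = v by exact: (twistK v (turn_unit t)).
have w0 : w != 0.
  by apply: contraNneq v0 => w0; rewrite -w_v w0 /turn twist0.
have tI : t \in @unit_interval R by apply/mem_set; rewrite /unit_interval /= in_itv.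
exists (SigSub (direction_sphere w0), SigSub tI); apply: val_inj.
rewrite -[LHS]/(param_row (turn (direction w) t) t).
apply/rowP => k; case/mxvec_indexP: k => j i; rewrite param_rowE.
rewrite -[RHS]/(set_val b ord0 (mxvec_index j i)).
have dE l : profile (turn (direction w) t) l = profile v l.
  rewrite /direction /turn twistZ -/(turn w t) w_v profileZ// invr_gt0 sqrtr_gt0.
  by rewrite sqn_gt0.
have -> : profile (turn (direction w) t) = profile v by exact/funext.
have -> : mass (turn (direction w) t) t = mass v t.
  by rewrite /mass (_ : profile (turn _ _) = profile v)//; exact/funext.
(* The coordinates of [b] sum to 1, so the scale [c] is the inverse of the mass. *)
have cN : c * mass v t = 1.
  rewrite -sum1 /mass mulr_sumr; apply: eq_bigr => j' _; rewrite mulr_sumr.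
  by apply: eq_bigr => i' _; rewrite bE.
have N0 : mass v t != 0.
  by apply: contraPneq cN => ->; rewrite mulr0 => /esym/eqP; rewrite oner_eq0.
by rewrite bE mulrC; congr (_ * _); apply: (mulIf N0); rewrite cN mulVf.
Qed.

(* [r] is minus the monodromy of [turn], because the antipode of the sphere
   corresponds to the involution [y |-> 1 - y] of profiles. *)
Variable r : sphere R m -> sphere R m.
Hypothesis rE : forall u, set_val (r u) = - twist (-1) 0 (set_val u).

(** The weights of [v] at time 1 are those of [- v] at time 0: both sit on block 0, and negation
    complements the profile. *)
Lemma param_glue p q : Defs.glue r p q -> param p = param q.
Proof.
case: p q => [u t] [u' t'] [/= t1 t0 ->]; apply: val_inj.
rewrite -[LHS]/(param_row (turn (set_val u) (set_val t)) (set_val t)).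
rewrite -[RHS]/(param_row (turn (set_val (r u)) (set_val t')) (set_val t')).
rewrite t1 t0 turn0 turn1 rE.
have v0 : twist (-1) 0 (set_val u) != 0.
  by rewrite -turn1; apply: turn_neq0; exact: sphere_neq0.
set v := twist _ _ _ in v0 *.
have [y01 _ _] := profile_normalized v0.
have [y01' _ _] : normalized (profile (- v)).
  by apply: profile_normalized; rewrite oppr_eq0.
have W j i : weight (profile v) 1 j i = weight (profile (- v)) 0 j i.
  have [->|j_] := eqVneq j j0; first by rewrite weight_start// weight_end// profileN.
  by rewrite !weight_ends//; [left|right].
apply/rowP => k; case/mxvec_indexP: k => j i; rewrite !param_rowE W; congr (_ / _).
by apply: eq_bigr => j' _; apply: eq_bigr => i' _; exact: W.
Qed.

(** Equal images have proportional weights, so [weight_fiber] applies. Profiles then give the turned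
    vectors up to a positive factor, and unit vectors on the same ray coincide. *)
Lemma param_fiber p q : param p = param q ->
  [\/ p = q, Defs.glue r p q | Defs.glue r q p].
Proof.
case: p q => [u t] [u' t'] /(congr1 set_val); rewrite !param_val /= => e.
have tu (w : sphere R m) (s : R) : turn (set_val w) s != 0.
  by apply: turn_neq0; exact: sphere_neq0.
have e' j i : weight (profile (turn (set_val u) (set_val t))) (set_val t) j i =
    mass (turn (set_val u) (set_val t)) (set_val t) /
    mass (turn (set_val u') (set_val t')) (set_val t') *
    weight (profile (turn (set_val u') (set_val t'))) (set_val t') j i.
  have := congr1 (fun x : 'rV_(3 * m.+2) => x ord0 (mxvec_index j i)) e.
  rewrite !param_rowE => /(canRL (divfK _)) ->; last first.
    rewrite gt_eqF//; apply: weight_sum_gt0; last exact: unit_interval_bounds.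
    exact: profile_normalized.
  by rewrite mulrC mulrA mulrAC.
have e0 : 0 < mass (turn (set_val u) (set_val t)) (set_val t) /
    mass (turn (set_val u') (set_val t')) (set_val t').
  by apply: divr_gt0; (apply: weight_sum_gt0; last exact: unit_interval_bounds);
    exact: profile_normalized.
have gluing (w w' : sphere R m) : (forall i, profile (turn (set_val w') 0) i =
    1 - profile (turn (set_val w) 1) i) -> w' = r w.
  move=> h; have nz : - turn (set_val w) 1 != 0 by rewrite oppr_eq0.
  have [i|a a0] := profile_inj (tu w' 0) nz; first by rewrite h profileN.
  by rewrite turn0 turn1 -rE => /sphere_scale; exact.
have := weight_fiber (profile_normalized (tu u _)) (profile_normalized (tu u' _))
  (unit_interval_bounds t) (unit_interval_bounds t') e0 e'.
case=> [[tt' pp]|[t1 t0 pp]|[t1 t0 pp]].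
- apply: Or31; rewrite -tt' in pp.
  have [a a0 ua] := profile_inj (tu u _) (tu u' _) pp.
  congr pair; last exact: val_inj.
  apply: (sphere_scale a0); rewrite -[LHS](twistVK _ (turn_unit (set_val t))).
  by rewrite -/(turn _ _) ua twistZ (twistVK _ (turn_unit _)).
- by rewrite t1 t0 in pp; apply: Or32; split=> //=; exact: gluing.
- by rewrite t1 t0 in pp; apply: Or33; split=> //=; exact: gluing.
Qed.

Lemma mapping_torus_realization : homeomorphic (mapping_torus R r) B.
Proof.
apply: (@homeomorphic_mapping_torus _ _ _ r param) => //.
- exact: compact_sphere.
- by apply: hausdorff_set_type; exact: norm_hausdorff.
- exact: param_continuous.
- exact: param_surj.
- exact: param_glue.
- exact: param_fiber.
Qed.

End Parametrization.

(** * The realization is a closed manifold *)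

Section Manifold.
Variables (R : realType) (m : nat).
Local Notation K := (sphere R m * set_type (@unit_interval R))%type.
Local Notation B := (realization R (BM m.+2)).

(** The conditions defining [BM] are symmetric in the blocks, so exchanging two of them yields a
    second parametrization, with its seam elsewhere. *)
Definition swap_row (x : 'rV[R]_(3 * m.+2)) : 'rV[R]_(3 * m.+2) :=
  mxvec (\matrix_(j, i) x ord0 (mxvec_index (tperm j0 j1 j) i)).

Lemma swap_rowE x j i :
  swap_row x ord0 (mxvec_index j i) = x ord0 (mxvec_index (tperm j0 j1 j) i).
Proof. by rewrite mxvecE mxE. Qed.

Lemma swap_row_realization (b : B) :
  swap_row (set_val b) \in realization_set R (BM m.+2).
Proof.
have /realization_setP[[M0 Mcol [k Mk] Mrow] sum1] := set_valP b.
apply/mem_set/realization_setP; split; last first.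
  rewrite -sum1 (reindex_inj (@perm_inj _ (tperm j0 j1))) /=.
  apply: eq_bigr => j _; apply: eq_bigr => i _.
  by rewrite swap_rowE tpermK.
split.
- by move=> j i; rewrite swap_rowE; exact: M0.
- move=> i j j'; rewrite !swap_rowE => h h'; apply: (@perm_inj _ (tperm j0 j1)).
  exact: Mcol h h'.
- by exists (tperm j0 j1 k) => i; rewrite swap_rowE tpermK.
- move=> j; have [i hi] := Mrow (tperm j0 j1 j).
  by exists i; rewrite swap_rowE.
Qed.

Definition swap (b : B) : B := SigSub (swap_row_realization b).

Lemma swapK : involutive swap.
Proof.
move=> b; apply: val_inj; rewrite -[LHS]/(swap_row (swap_row (set_val b))).
apply/rowP => k; case/mxvec_indexP: k => j i.
by rewrite !swap_rowE tpermK.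
Qed.

Lemma swap_continuous : continuous swap.
Proof.
apply: continuous_set_val; apply: continuous_mx => o k; rewrite (ord1 o).
case/mxvec_indexP: k => j i.
rewrite (_ : (fun _ => _) = fun b : B =>
    set_val b ord0 (mxvec_index (tperm j0 j1 j) i)); last first.
  by apply/funext => b; exact: swap_rowE.
by apply: cont_coord; exact: set_val_continuous.
Qed.

Variable r : sphere R m -> sphere R m.
Hypothesis rE : forall u, set_val (r u) = - twist (-1) 0 (set_val u).

Lemma param_inj_interior (p q : K) :
  param p = param q -> 0 < (set_val p.2 : R) < 1 -> p = q.
Proof.
move=> /(param_fiber rE)[//|[-> _ _]|[_ -> _]]; by rewrite ltxx ?andbF.
Qed.

Lemma param_ends (p : K) j i : ~ (0 < (set_val p.2 : R) < 1) -> j != j0 ->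
  set_val (param p) ord0 (mxvec_index j i) = 0.
Proof.
move=> p01 jn0; rewrite param_val param_rowE weight_ends ?mul0r//.
  move=> l; rewrite profile_ge0 ?profile_le1//;
    by apply: turn_neq0; exact: sphere_neq0.
have /andP[] := unit_interval_bounds p.2; rewrite !le_eqVlt.
move=> /orP[/eqP <-|p0]; first by left.
by move=> /orP[/eqP ->|p1]; [right|rewrite p0 p1 in p01].
Qed.

(* The ends of the cylinder have all their weight on block 0, so they miss those
   of the parametrization composed with the exchange of the blocks 0 and 1. *)
Lemma realization_locally_euclidean : locally_euclidean R m.+1 B.
Proof.
have hB : hausdorff_space B by apply: hausdorff_set_type; exact: norm_hausdorff.
move=> x.
have [xint|] := pselect (forall p : K, param p = x -> 0 < (set_val p.2 : R) < 1).
  apply: (@open_shell_chart _ _ _ (@param R m)) => //.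
  - exact: param_continuous.
  - exact: param_surj.
  - exact: param_inj_interior.
move=> /existsNP[p /not_implyP[px p01]].
apply: (@open_shell_chart _ _ _ (swap \o @param R m)) => //.
- move=> q; apply: continuous_comp; first exact: param_continuous.
  exact: swap_continuous.
- by move=> b; have [q qb] := param_surj (swap b); exists q; rewrite /= qb swapK.
- by move=> q q' /(inv_inj swapK); exact: param_inj_interior.
- move=> q qx; apply: contrapT => q01.
  (* If [q] were on an end too, [x] would vanish on block 0, and it vanishes on the others by [px];
     but its total weight is 1. *)
  have /realization_setP[_ ] := set_valP x.
  rewrite big1 => [/esym/eqP|j _]; first by rewrite oner_eq0.
  rewrite big1// => i _; have [->|jn0] := eqVneq j j0.
    rewrite -qx -[LHS]/(swap_row (set_val (param q)) ord0 (mxvec_index j0 i)).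
    by rewrite swap_rowE tpermL param_ends.
  by rewrite -px; exact: param_ends.
Qed.

Lemma BM_simplicial_manifold : simplicial_manifold R m.+1 (BM m.+2).
Proof.
have compB : compact [set: B].
  have -> : [set: B] = @param R m @` setT.
    by apply/seteqP; split=> // b _; have [p <-] := param_surj b; exists p.
  apply: continuous_compact; last exact: compact_sphere_cylinder.
  by apply: continuous_subspaceT; exact: param_continuous.
split; first exact: BM_simplicial.
split=> //.
- by apply: hausdorff_set_type; exact: norm_hausdorff.
- exact: second_countable_set_type.
- exact: realization_locally_euclidean.
Qed.

End Manifold.

Theorem theorem6p3 (R : realType) (d : nat) (hd : (2 <= d)%N) :
  exists BM : {set {set 'I_(3 * d)}},
    [/\ simplicial_manifold R (d - 1) BM,
        balanced d BM
      & if odd d then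
          homeomorphic (realization R BM)
            (sphere R (d - 2) * sphere R 1)%type
        else
          homeomorphic (realization R BM)
            (nonorientable_sphere_bundle R (d - 2))].
Proof.
case: d hd => [|[|m]]// _; exists (BM m.+2).
rewrite subn1 /= !subSS subn0 negbK.
have [om|om] := boolP (odd m).
(* Here the half turn is the antipode, so the gluing map is the identity. *)
- have rE (u : sphere R m) : set_val (id u) = - twist (-1) 0 (set_val u).
    by rewrite twistN1_odd// opprK.
  split; [exact: BM_simplicial_manifold rE|exact: BM_balanced|].
  apply: (homeomorphic_trans (homeomorphic_sym (mapping_torus_realization rE))).
  apply: mapping_torus_id; first exact: compact_sphere.
  by apply: hausdorff_set_type; exact: norm_hausdorff.
(* Here the half turn fixes coordinate 0, so its negative, the gluing map, is the reflection. *)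
- have rE (u : sphere R m) :
      set_val (sphere_reflection u) = - twist (-1) 0 (set_val u).
    by rewrite twistN1_even// opprK.
  split; [exact: BM_simplicial_manifold rE|exact: BM_balanced|].
  exact: homeomorphic_sym (mapping_torus_realization rE).
Qed.
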